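(* For a Szász-Hájek groupoid $\mathbb{A}$ the following two conditions are equivalent: (i) $\mathbb{A}$ has a minimal clone; (ii) $\mathbb{A}$ or its dual belongs to the variety $\mathcal{B}$.
   Context: A groupoid is a (nonempty, possibly infinite) set with a single binary operation, written $xy$. The dual of a groupoid $(A;f)$ is $(A;f^d)$ with $f^d(x,y)=f(y,x)$. A Szász-Hájek groupoid (SH-groupoid) is a groupoid with exactly one nonassociative triple, i.e. there is exactly one $(a,b,c)\in A^3$ with $(ab)c\neq a(bc)$. Clones: a clone on a set $A$ is a set of finitary operations on $A$ that contains all projections and is closed under composition. The clone $Clo(\mathbb{A})$ of an algebra $\mathbb{A}$ is the set of its term functions. The trivial clone on $A$ is the clone of all projections. A clone is minimal if it is not trivial and its only proper subclone is the trivial clone. We say that a groupoid $\mathbb{A}$ has a minimal clone if it is idempotent ($xx\approx x$) and $Clo(\mathbb{A})$ is a minimal clone. $\mathcal{B}$ is the variety of groupoids defined by the identities $xx\approx x$ and $x(xy)\approx x(yx)\approx (xy)x\approx (xy)y\approx (xy)(yx)\approx xy$. *)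

(* Defs.v *)
From mathcomp Require Import all_boot.

Set Implicit Arguments.
Unset Strict Implicit.
Unset Printing Implicit Defensive.

(* A groupoid (A; f) is a type A with a binary operation op : A -> A -> A. *)

Definition dual (A : Type) (op : A -> A -> A) : A -> A -> A :=
  fun x y => op y x.

Definition nonassociative_triple (A : Type) (op : A -> A -> A)
    (t : A * A * A) : Prop :=
  let: (a, b, c) := t in op (op a b) c <> op a (op b c).

(* Nonemptiness of A is implied by the existence of the triple. *)
Definition SH_groupoid (A : Type) (op : A -> A -> A) : Prop :=
  exists! t : A * A * A, nonassociative_triple op t.

Definition operation (A : Type) (n : nat) : Type := ('I_n -> A) -> A.

Definition projection (A : Type) (n : nat) (i : 'I_n) : operation A n :=
  fun x => x i.

Definition compose (A : Type) (n k : nat)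
    (f : operation A n) (g : 'I_n -> operation A k) : operation A k :=
  fun x => f (fun i => g i x).

(* F n f means that the n-ary operation f belongs to the set F.  Arity 0 is
   allowed; neither the projections nor the term functions of a groupoid
   include nullary operations. *)
Definition opset (A : Type) : Type := forall n : nat, operation A n -> Prop.

Definition opset_sub (A : Type) (F G : opset A) : Prop :=
  forall (n : nat) (f : operation A n), F n f -> G n f.

Definition opset_eq (A : Type) (F G : opset A) : Prop :=
  forall (n : nat) (f : operation A n), F n f <-> G n f.

Record is_clone (A : Type) (F : opset A) : Prop := IsClone {
  clone_projection : forall (n : nat) (i : 'I_n), F n (projection i);
  clone_compose : forall (n k : nat)
      (f : operation A n) (g : 'I_n -> operation A k),
    F n f -> (forall i, F k (g i)) -> F k (compose f g)
}.

Definition trivial_clone (A : Type) : opset A :=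
  fun n f => exists i : 'I_n, f = projection i.

Definition proper_subclone (A : Type) (G F : opset A) : Prop :=
  [/\ is_clone G, opset_sub G F & ~ opset_eq G F].

Definition minimal_clone (A : Type) (F : opset A) : Prop :=
  [/\ is_clone F,
      ~ opset_eq F (@trivial_clone A) &
      forall G : opset A, proper_subclone G F -> opset_eq G (@trivial_clone A)].

Inductive term (n : nat) : Type :=
| Var of 'I_n
| Mul of term n & term n.

Fixpoint term_fun (A : Type) (op : A -> A -> A) (n : nat) (t : term n) :
    operation A n :=
  fun x =>
    match t with
    | Var i => x i
    | Mul s u => op (term_fun op s x) (term_fun op u x)
    end.

Definition Clo (A : Type) (op : A -> A -> A) : opset A :=
  fun n f => exists t : term n, f = term_fun op t.

Definition has_minimal_clone (A : Type) (op : A -> A -> A) : Prop :=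
  idempotent_op op /\ minimal_clone (Clo op).

Record in_variety_B (A : Type) (op : A -> A -> A) : Prop := InVarietyB {
  B_idem : forall x, op x x = x;
  B_x_xy : forall x y, op x (op x y) = op x y;
  B_x_yx : forall x y, op x (op y x) = op x y;
  B_xy_x : forall x y, op (op x y) x = op x y;
  B_xy_y : forall x y, op (op x y) y = op x y;
  B_xy_yx : forall x y, op (op x y) (op y x) = op x y
}.

(* Main.v *)
Require Import Defs.
From mathcomp Require Import all_boot.
From Stdlib Require Import Classical FunctionalExtensionality PropExtensionality.

Set Implicit Arguments.
Unset Strict Implicit.
Unset Printing Implicit Defensive.

(** In B the binary terms are x, y, xy and yx, and the last two absorb
    everything.  This makes the clone of a groupoid in B minimal unless the
    multiplication is a projection, hence associative: given a term that is
    not a projection, with leftmost variable x_i, substitute x for x_i and y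
    for every other variable; the result is xy or yx, so each nontrivial
    subclone contains the multiplication ([leftmost_isolate_term],
    [B_minimal]).

    For the converse, let (a, b, c) be the nonassociative triple and consider
    the binary term w(x, y) = x(x(yx)).  The groupoid (A; w) lies in B.  Indeed
    w is xyx in a band, and x, y, xyx, yxy obey the identities of B in every
    band; moreover the complement of each of a, b, c is a subgroupoid
    ([irreducible]), hence a band, so only pairs x, y that no such complement
    contains need a closer look.  There is no such pair if a, b, c are
    distinct.  If the triple has only two distinct entries, then up to duality
    it is (a, a, b) or (a, b, a), and there is enough associativity left for
    the band computation to go through ([long_sandwich_B_at]).

    By minimality w is a projection or generates the multiplication.  In the
    second case the multiplication is a nontrivial binary term of (A; w), so it
    is w or its dual, which is the claim ([B_term_reduction]).  The second
    projection satisfies the identities of B only on a one-element set, so it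
    remains to refute w(x, y) = x.  For a repeated entry this equation gives
    a = (ab)(ba), which contradicts the irreducibility of a.  For distinct
    entries it makes every two-generated subgroupoid a rectangular band; then
    factoring a as a(ca) and c as (ca)c leaves few possibilities for ca, and
    each of them is absurd ([distinct_ne_fst]).

    The form x(x(yx)), rather than x(yx), matters for the triple (a, a, b)
    only: x(w(x, y)) = w(x, y) has to hold also when x = a, where the law
    x(xz) = xz is the one that fails. *)

(** * Clones generated by a binary operation *)

Inductive binary_term (A : Type) (op : A -> A -> A) : (A -> A -> A) -> Prop :=
| binary_term_fst : binary_term op (fun x _ => x)
| binary_term_snd : binary_term op (fun _ y => y)
| binary_term_mul f g : binary_term op f -> binary_term op g ->
    binary_term op (fun x y => op (f x y) (g x y)).

Lemma fun2_ext (A B C : Type) (f g : A -> B -> C) :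
  (forall x y, f x y = g x y) -> f = g.
Proof.
by move=> fg; apply: functional_extensionality => x;
  apply: functional_extensionality.
Qed.

Definition bin (A : Type) (f : A -> A -> A) : operation A 2 :=
  fun x => f (x ord0) (x ord_max).

Definition pair_op (A : Type) (n : nat) (f g : operation A n) (i : 'I_2) :
  operation A n := if i == ord0 then f else g.

(** As a substitution this keeps the variable i apart and merges all others,
    turning a term into a binary one. *)
Definition isolate (A : Type) (n : nat) (i : 'I_n) (x y : A) : 'I_n -> A :=
  fun k => if k == i then x else y.

Section Clones.

Variables (A : Type) (op : A -> A -> A).

Fixpoint subst_term (n k : nat) (s : 'I_n -> term k) (t : term n) : term k :=
  match t with
  | Var i => s i
  | Mul t1 t2 => Mul (subst_term s t1) (subst_term s t2)
  end.

Lemma term_fun_subst n k (s : 'I_n -> term k) (t : term n) x :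
  term_fun op (subst_term s t) x = term_fun op t (fun i => term_fun op (s i) x).
Proof. by elim: t => //= t1 -> t2 ->. Qed.

Lemma Clo_is_clone : is_clone (Clo op).
Proof.
split=> [n i | n k f g [t ->] hg]; first by exists (Var i).
have [s hs] := fin_all_exists hg.
exists (subst_term s t); apply: functional_extensionality => x.
rewrite term_fun_subst /compose; congr (term_fun op t _).
by apply: functional_extensionality => i; rewrite hs.
Qed.

Lemma Clo_least (s : A -> A -> A) (G : opset A) :
  is_clone G -> G 2 (bin s) -> opset_sub (Clo s) G.
Proof.
move=> [hproj hcomp] hs n f [t ->].
elim: t => [i | t1 IH1 t2 IH2]; first exact: hproj.
have h : forall i, G n (pair_op (term_fun s t1) (term_fun s t2) i).
  by move=> i; rewrite /pair_op; case: ifP.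
exact: (hcomp _ _ _ _ hs h).
Qed.

Lemma binary_term_isolate n (t : term n) (i : 'I_n) :
  binary_term op (fun x y => term_fun op t (isolate i x y)).
Proof.
elim: t => [j | t IHt u IHu] /=; last exact: (binary_term_mul IHt IHu).
by rewrite /isolate; case: (j == i); constructor.
Qed.

Lemma bin_in_Clo (f : A -> A -> A) :
  Clo op (bin f) <-> binary_term op f.
Proof.
split=> [[t ht] | ].
  have -> : f = fun x y => term_fun op t (isolate ord0 x y).
    by apply: fun2_ext => x y; rewrite -ht.
  exact: binary_term_isolate.
elim=> [ | | {}f g _ [t ht] _ [u hu]].
- by exists (Var ord0).
- by exists (Var ord_max).
- exists (Mul t u); apply: functional_extensionality => x /=.
  by rewrite -ht -hu.
Qed.

Lemma bin_projection (f : A -> A -> A) (i : 'I_2) :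
  bin f = projection i -> f = (fun x _ => x) \/ f = (fun _ y => y).
Proof.
move=> hf.
have {}hf : f = fun x y => isolate ord0 x y i.
  apply: fun2_ext => x y.
  exact: (congr1 (fun g => g (isolate ord0 x y)) hf).
by rewrite hf /isolate; case: (i == ord0); [left | right].
Qed.

End Clones.

(** The clone of s is a subclone of the minimal clone of op, hence trivial or
    everything. *)
Lemma minimal_generates (A : Type) (op s : A -> A -> A) :
  has_minimal_clone op -> binary_term op s ->
  [\/ s = (fun x _ => x), s = (fun _ y => y) | binary_term s op].
Proof.
move=> [_ [hclone _ hmin]] /bin_in_Clo hs.
have [heq | hne] := classic (opset_eq (Clo s) (Clo op)).
  constructor 3; apply/bin_in_Clo/heq.
  by apply/bin_in_Clo; apply: binary_term_mul; constructor.
have proper : proper_subclone (Clo s) (Clo op).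
  by split=> //; [exact: Clo_is_clone | exact: Clo_least].
have sClo : Clo s (bin s).
  by apply/bin_in_Clo; apply: binary_term_mul; constructor.
have [i /bin_projection[] ->] := proj1 (hmin _ proper 2 (bin s)) sClo.
  by constructor 1.
by constructor 2.
Qed.

Lemma Clo_dual (A : Type) (op : A -> A -> A) : Clo (dual op) = Clo op.
Proof.
have sub (s : A -> A -> A) : opset_sub (Clo (dual s)) (Clo s).
  apply: Clo_least; first exact: Clo_is_clone.
  by apply/bin_in_Clo; apply: binary_term_mul; constructor.
apply: functional_extensionality_dep => n; apply: functional_extensionality => f.
apply: propositional_extensionality.
by split; [apply: sub | apply: (sub (dual op))].
Qed.

Lemma has_minimal_clone_dual (A : Type) (op : A -> A -> A) :
  has_minimal_clone (dual op) <-> has_minimal_clone op.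
Proof. by rewrite /has_minimal_clone Clo_dual. Qed.

(** * Terms in the variety B *)

Section VarietyB.

Variables (A : Type) (s : A -> A -> A).
Hypothesis sB : in_variety_B s.

Definition proper_word (f : A -> A -> A) := f = s \/ f = dual s.

Definition word (f : A -> A -> A) :=
  [\/ f = (fun x _ => x), f = (fun _ y => y) | proper_word f].

(** The words xy and yx form an ideal among x, y, xy, yx: this and the next
    lemma are what the identities of B say. *)
Lemma proper_word_mull f g :
  proper_word f -> word g -> proper_word (fun x y => s (f x y) (g x y)).
Proof.
case: sB => h1 h2 h3 h4 h5 h6.
by case=> -> [-> | -> | [-> | ->]];
   [left | left | left | left | right | right | right | right];
   apply: fun2_ext => x y; rewrite /dual ?(h1, h2, h3, h4, h5, h6).
Qed.

Lemma proper_word_mulr f g :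
  word f -> proper_word g -> proper_word (fun x y => s (f x y) (g x y)).
Proof.
case: sB => h1 h2 h3 h4 h5 h6.
by case=> [-> | -> | [-> | ->]] [-> | ->];
   [left | left | right | right | left | left | right | right];
   apply: fun2_ext => x y; rewrite /dual ?(h1, h2, h3, h4, h5, h6).
Qed.

Lemma word_fst : word (fun x _ => x). Proof. by constructor 1. Qed.
Lemma word_snd : word (fun _ y => y). Proof. by constructor 2. Qed.

Lemma mul_fst_fst : (fun x _ : A => s x x) = fun x _ => x.
Proof. by apply: fun2_ext => x y; apply: B_idem. Qed.

Lemma mul_snd_snd : (fun _ y : A => s y y) = fun _ y => y.
Proof. by apply: fun2_ext => x y; apply: B_idem. Qed.

Lemma B_binary_term f : binary_term s f -> word f.
Proof.
elim=> [ | | {}f g _ hf _ hg]; [exact: word_fst | exact: word_snd | ].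
case: (hf) => [-> | -> | pf]; last by constructor 3; apply: proper_word_mull.
- case: (hg) => [-> | -> | pg]; first by rewrite mul_fst_fst; constructor.
    by constructor 3; left.
  by constructor 3; apply: proper_word_mulr => //; apply: word_fst.
- case: (hg) => [-> | -> | pg]; last first.
  + by constructor 3; apply: proper_word_mulr => //; apply: word_snd.
  + by rewrite mul_snd_snd; constructor.
  by constructor 3; right.
Qed.

Lemma isolate_projection n (t : term n) (i : 'I_n) :
  term_fun s t = projection i ->
  (fun x y => term_fun s t (isolate i x y)) = (fun x _ => x).
Proof. by move=> ->; rewrite /projection /isolate eqxx. Qed.

Lemma isolate_word n (t : term n) (i : 'I_n) :
  word (fun x y => term_fun s t (isolate i x y)).
Proof. exact/B_binary_term/binary_term_isolate. Qed.

(** The first alternative speaks of the whole n-ary term function, not of the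
    binary function being x: this is what lets a product of two terms be
    recognized as a projection by idempotence. *)
Lemma isolate_term n (t : term n) (i : 'I_n) :
  [\/ term_fun s t = projection i,
      (fun x y => term_fun s t (isolate i x y)) = (fun _ y => y) |
      proper_word (fun x y => term_fun s t (isolate i x y))].
Proof.
elim: t => [j | t IHt u IHu] /=.
  have [-> | ne_ji] := eqVneq j i; first by constructor 1.
  by constructor 2; rewrite /isolate (negbTE ne_ji).
have wt := isolate_word t i; have wu := isolate_word u i.
case: IHt => [pt | et | ]; last by constructor 3; apply: proper_word_mull.
- case: IHu => [pu | eu | ]; last by constructor 3; apply: proper_word_mulr.
    by constructor 1; rewrite pt pu; apply: functional_extensionality => x;
      apply: B_idem.
  constructor 3; left; apply: fun2_ext => x y.
  by rewrite (congr1 (fun f => f x y) (isolate_projection pt))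
             (congr1 (fun f => f x y) eu).
- case: IHu => [pu | eu | ]; last by constructor 3; apply: proper_word_mulr.
    constructor 3; right; apply: fun2_ext => x y.
    by rewrite (congr1 (fun f => f x y) (isolate_projection pu))
               (congr1 (fun f => f x y) et).
  constructor 2; apply: fun2_ext => x y.
  by rewrite (congr1 (fun f => f x y) et) (congr1 (fun f => f x y) eu)
             (B_idem sB).
Qed.

(** The witness is the leftmost variable of t: merging the others then yields
    a word that starts with x, and the outcome y of [isolate_term] does not
    occur along the left spine. *)
Lemma leftmost_isolate_term n (t : term n) :
  exists i : 'I_n, term_fun s t = projection i \/
    proper_word (fun x y => term_fun s t (isolate i x y)).
Proof.
elim: t => [i | t [i IHt] u _] /=; first by exists i; left.
exists i; case: IHt => [pt | vt]; last first.
  by right; apply: proper_word_mull => //; apply: isolate_word.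
have vt := isolate_projection pt.
case: (isolate_term u i) => [pu | vu | vu].
- by left; rewrite pt pu; apply: functional_extensionality => x;
      apply: B_idem.
- right; left; apply: fun2_ext => x y.
  by rewrite (congr1 (fun f => f x y) vt) (congr1 (fun f => f x y) vu).
- by right; apply: proper_word_mulr => //; rewrite vt; apply: word_fst.
Qed.

(** A subclone with a nontrivial member contains xy or yx, by isolating the
    leftmost variable, and either of these generates the whole clone. *)
Lemma B_minimal :
  s <> (fun x _ => x) -> s <> (fun _ y => y) -> has_minimal_clone s.
Proof.
move=> ne_fst ne_snd; split; first exact: B_idem.
split; first exact: Clo_is_clone.
  move=> triv.
  have [|i /bin_projection[]//] := proj1 (triv 2 (bin s)).
  by apply/bin_in_Clo; apply: binary_term_mul; constructor.
move=> G [Gclone G_sub G_ne] n f; split=> [Gf | [i ->]]; last first.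
  exact: clone_projection.
have [t ft] := G_sub _ _ Gf.
have [i [pt | wt]] := leftmost_isolate_term t; first by exists i; rewrite ft.
case: G_ne => m g; split; first exact: G_sub.
set w := (fun x y => _) in wt.
suff Gw : G 2 (bin w).
  have -> : Clo s = Clo w by case: wt => ->; [ | rewrite (Clo_dual s)].
  exact: Clo_least.
have -> : bin w =
    compose f (isolate i (projection ord0) (projection ord_max)).
  apply: functional_extensionality => x; rewrite /bin /w /compose ft.
  congr (term_fun s t _); apply: functional_extensionality => k.
  by rewrite /isolate; case: (k == i).
apply: (clone_compose Gclone Gf) => k.
by rewrite /isolate; case: (k == i); apply: clone_projection.
Qed.

End VarietyB.

(** If w is not a projection, then op is itself a binary term of w, and the only
    such terms are x, y, w(x, y) and w(y, x).  The second projection belongs to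
    B only if A is a singleton, because x(yx) = xy then reads x = y. *)
Lemma B_term_reduction (A : Type) (op w : A -> A -> A) :
  has_minimal_clone op -> ~ associative op ->
  binary_term op w -> in_variety_B w -> w <> (fun x _ => x) ->
  in_variety_B op \/ in_variety_B (dual op).
Proof.
move=> minop nassoc wop wB ne_fst.
case: (minimal_generates minop wop) => [wE | wE | opw]; first by case: (ne_fst wE).
  have eqA (x y : A) : x = y by have := B_x_yx wB x y; rewrite wE.
  by case: nassoc.
have [opE | opE | [-> | ->]] := B_binary_term wB opw; [ | | by left | by right].
- by case: nassoc; rewrite opE.
- by case: nassoc; rewrite opE.
Qed.

(** * A band-like term in a groupoid with one nonassociative triple *)

Definition sole_nonassociative (A : Type) (op : A -> A -> A) (a b c : A) : Prop :=
  op (op a b) c <> op a (op b c) /\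
  forall x y z, x <> a \/ y <> b \/ z <> c -> op (op x y) z = op x (op y z).

Lemma sole_nonassociative_dual (A : Type) (op : A -> A -> A) (a b c : A) :
  sole_nonassociative op a b c -> sole_nonassociative (dual op) c b a.
Proof.
case=> ne_abc assoc; split; first by apply: nesym.
by move=> x y z ne; rewrite /dual assoc //; tauto.
Qed.

Definition long_sandwich (A : Type) (op : A -> A -> A) (x y : A) : A :=
  op x (op x (op y x)).

Lemma long_sandwich_binary_term (A : Type) (op : A -> A -> A) :
  binary_term op (long_sandwich op).
Proof. by do !apply: binary_term_mul; constructor. Qed.

(** The identities of B at a single pair; each pair of elements of the groupoid
    needs its own argument for them. *)
Definition B_at (A : Type) (u : A -> A -> A) (x y : A) : Prop :=
  [/\ u x (u x y) = u x y, u x (u y x) = u x y, u (u x y) x = u x y,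
      u (u x y) y = u x y & u (u x y) (u y x) = u x y].

Lemma in_variety_B_at (A : Type) (u : A -> A -> A) :
  idempotent_op u -> (forall x y, B_at u x y) -> in_variety_B u.
Proof. by move=> uid uB; split=> // x y; case: (uB x y). Qed.

Section Sandwich.

Variables (A : Type) (op : A -> A -> A).
Hypothesis opxx : idempotent_op op.

Local Notation "x ** y" := (op x y) (at level 40, left associativity).
Local Notation w := (long_sandwich op).

(** The left nucleus of the subgroupoid S. *)
Definition left_nuclear (S : A -> Prop) (u : A) : Prop :=
  forall y z, S y -> S z -> (u ** y) ** z = u ** (y ** z).

Lemma left_nuclear_mul (S : A -> Prop) u v :
  (forall x y, S x -> S y -> S (x ** y)) -> S v ->
  left_nuclear S u -> left_nuclear S v -> left_nuclear S (u ** v).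
Proof.
move=> Smul Sv nu nv y z Sy Sz.
by rewrite (nu v y) // nu ?nv ?nu //; auto.
Qed.

(** The computation showing that xyx and yxy obey the identities of B in a band,
    organized so that it uses little associativity.  Since the left nucleus is
    closed under products, yxy is in it along with y and yx, and then only five
    instances of associativity starting with x are called for. *)
Lemma long_sandwich_B_at (S : A -> Prop) (x y : A) :
  (forall u v, S u -> S v -> S (u ** v)) -> S x -> S y ->
  left_nuclear S y -> left_nuclear S (y ** x) ->
  let e := y ** x in let g := x ** e in
  [/\ (x ** e) ** x = x ** (e ** x), (x ** g) ** x = x ** (g ** x),
      (x ** x) ** g = x ** (x ** g), (x ** e) ** e = x ** (e ** e) &
      (x ** g) ** e = x ** (g ** e)] ->
  B_at w x y /\ B_at w y x.
Proof.
move=> Smul Sx Sy ny ne e g [xex xgx xxg xee xge].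
(* In a band f and h are xyx and yxy. *)
pose f := x ** g; pose h := e ** y.
rewrite -/e in ne.
have Se : S e by apply: Smul.
have Sg : S g by apply: Smul.
have Sf : S f by apply: Smul.
have Sh : S h by apply: Smul.
have nh : left_nuclear S h by apply: left_nuclear_mul.
have ex : e ** x = e by rewrite ny // opxx.
have ye : y ** e = e by rewrite -ny // opxx.
have yh : y ** h = h by rewrite -ny // ye.
have hy : h ** y = h by rewrite ne // opxx.
have eh : e ** h = h by rewrite -ne // opxx.
have hx : h ** x = e by rewrite ne // opxx.
have gx : g ** x = g by rewrite xex ex.
have fx : f ** x = f by rewrite xgx gx.
have xf : x ** f = f by rewrite -xxg opxx.
have ge : g ** e = g by rewrite xee opxx.
have fe : f ** e = f by rewrite xge ge.
have eg : e ** g = e by rewrite -ne // ex opxx.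
have yf : y ** f = e by rewrite -ny.
have hf : h ** f = e by rewrite ne // yf opxx.
have wxy : w x y = f by [].
have wyx : w y x = h by rewrite /w -(ny y) ?opxx -?ny //; auto.
rewrite /B_at wxy wyx; split; split; rewrite /w.
- by rewrite fx !xf.
- by rewrite hx.
- by rewrite xf !opxx.
- by rewrite yf !fe.
- by rewrite hf !fe.
- by rewrite hy !yh.
- by rewrite -(ny f) // yf -/h !yh.
- by rewrite yh !opxx.
- by rewrite -(nh x) // hx eh opxx.
- by rewrite -(nh f) // hf eh opxx.
Qed.

End Sandwich.

(** * Factorizations of the entries of the nonassociative triple *)

Section SzaszHajek.

Variables (A : Type) (op : A -> A -> A) (a b c : A).
Hypothesis abc : sole_nonassociative op a b c.

Local Notation "x ** y" := (op x y) (at level 40, left associativity).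

Lemma assoc_off x y z : x <> a \/ y <> b \/ z <> c -> (x ** y) ** z = x ** (y ** z).
Proof. by case: abc => _; apply. Qed.

Lemma not_associative : ~ associative op.
Proof. by case: abc => ne_abc _ assoc; apply: ne_abc; rewrite assoc. Qed.

(** If a = uv, then (ab)c and a(bc) are linked by the five sides of the pentagon
    on u, v, b, c, of which one is the nonassociative triple; so one of the
    other four triples must be (a, b, c) too. *)
Lemma left_factor u v : u ** v = a -> v = a \/ u = a /\ (v ** b = b \/ v = b).
Proof.
move=> uv; apply: NNPP => H; case: abc => + _; apply.
rewrite -{1 2}uv (assoc_off (x := u) (y := v)); last by tauto.
by rewrite assoc_off ?assoc_off //; tauto.
Qed.

(** The same pentagon argument, on a, u, v, c with uv = b. *)
Lemma middle_irreducible u v : u ** v = b -> u = b \/ v = b.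
Proof.
move=> uv; apply: NNPP => H; case: abc => + _; apply.
by rewrite -{1 2}uv -(assoc_off (x := a)) ?assoc_off //; tauto.
Qed.

End SzaszHajek.

Section SzaszHajekTypes.

Variables (A : Type) (op : A -> A -> A).
Hypothesis opxx : idempotent_op op.

Local Notation "x ** y" := (op x y) (at level 40, left associativity).
Local Notation w := (long_sandwich op).

(** Equivalently, removing an entry of the nonassociative triple leaves a
    subgroupoid. *)
Lemma irreducible a b c t u v : sole_nonassociative op a b c ->
  [\/ t = a, t = b | t = c] -> u ** v = t -> u = t \/ v = t.
Proof.
move=> abc [] ->.
- by case/(left_factor abc) => [ | []]; [right | left].
- exact: (middle_irreducible abc).
- by case/(left_factor (sole_nonassociative_dual abc)) => [ | []]; [left | right].
Qed.

(** Both x and y lie in the complement of t, which is a band. *)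
Lemma B_at_avoiding a b c t x y : sole_nonassociative op a b c ->
  [\/ t = a, t = b | t = c] -> x <> t -> y <> t -> B_at w x y.
Proof.
move=> abc t_abc xt yt.
pose S z := z <> t.
have Smul u v : S u -> S v -> S (u ** v).
  by move=> Su Sv uv; case: (irreducible abc t_abc uv).
have assocS u v z : S u -> S v -> S z -> (u ** v) ** z = u ** (v ** z).
  move=> Su Sv Sz; apply: (assoc_off abc).
  by case: t_abc => tE; rewrite -tE; tauto.
suff [] : B_at w x y /\ B_at w y x by [].
apply: (@long_sandwich_B_at _ _ opxx S) => //.
- by move=> *; apply: assocS.
- by move=> *; apply: assocS => //; apply: Smul.
- by split; apply: assocS; auto.
Qed.

Lemma in_variety_B_pair a b c p q : sole_nonassociative op a b c ->
  [\/ p = a, p = b | p = c] -> [\/ q = a, q = b | q = c] -> p <> q ->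
  B_at w p q /\ B_at w q p -> in_variety_B w.
Proof.
move=> abc p_abc q_abc ne_pq [Bpq Bqp].
apply: in_variety_B_at => [x | x y]; first by rewrite /w !opxx.
have [xp | xp] := classic (x = p); have [yq | yq] := classic (y = q).
- by rewrite xp yq.
- by apply: (B_at_avoiding abc q_abc) => //; rewrite xp.
- by apply: (B_at_avoiding abc p_abc) => //; rewrite yq; apply: nesym.
have [yp | yp] := classic (y = p); last exact: (B_at_avoiding abc p_abc).
have [xq | xq] := classic (x = q); first by rewrite yp xq.
exact: (B_at_avoiding abc q_abc).
Qed.

(** * Triples with a repeated entry *)

(** If ba = a, then d = a(ab) satisfies da = a and db = d.  Either d = a and
    d = db = ab, or (d, a, b) associates and ab = (da)b = d(ab) = d; but d and
    ab are the two sides of the failing identity. *)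
Lemma type_aab_products a b : sole_nonassociative op a a b ->
  [/\ a ** b <> a, a ** b <> b & b ** a <> a].
Proof.
move=> aab; have assoc := assoc_off aab; have [+ _] := aab; rewrite opxx => ne.
have ca : a ** b <> a by move=> e; apply: ne; rewrite !e opxx.
have cb : a ** b <> b by move=> e; apply: ne; rewrite !e.
have ab : a <> b by move=> e; apply: ne; rewrite -e !opxx.
split=> // ba; apply: ne.
set d := a ** (a ** b).
have ca_a : (a ** b) ** a = a by rewrite assoc ?ba ?opxx //; auto.
have da : d ** a = a by rewrite /d assoc ?ca_a ?opxx //; auto.
have db : d ** b = d by rewrite /d assoc ?assoc ?opxx //; auto.
have [d_a | d_a] := classic (d = a); first by rewrite -db d_a.
rewrite -{1}da assoc; last by auto.
by rewrite {1}/d assoc ?opxx //; auto.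
Qed.

(** Hence (a, a(ba), ba) is an associative triple. *)
Lemma type_aab_off a b : sole_nonassociative op a a b ->
  a ** (b ** a) <> a \/ b ** a <> b.
Proof.
case/type_aab_products => ab_a _ _.
by have [-> | ] := classic (b ** a = b); [left | right].
Qed.

(** The band computation goes through at (a, b): among the triples that it
    needs, those that could be (a, a, b) are (a, a, a(ba)) and (a, a(ba), ba),
    and they are not, by the irreducibility of b and by [type_aab_off]. *)
Lemma type_aab_B a b : sole_nonassociative op a a b -> in_variety_B w.
Proof.
move=> aab; have assoc := assoc_off aab; have [ca cb ea] := type_aab_products aab.
have ab : a <> b by move=> e; apply: ca; rewrite -e opxx.
apply: (@in_variety_B_pair a a b a b) => //; [by constructor | by constructor | ].
apply: (@long_sandwich_B_at _ _ opxx (fun _ => True)) => //.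
- by move=> *; apply: assoc; left; apply: nesym.
- by move=> *; apply: assoc; left.
have gb : a ** (b ** a) <> b.
  move=> g_b; have t3 : [\/ b = a, b = a | b = b] by constructor 3.
  case: (irreducible aab t3 g_b) => // e_b.
  by apply: cb; rewrite -{2}g_b e_b.
have ge := type_aab_off aab.
by split; apply: assoc; rewrite ?opxx; tauto.
Qed.

(** If w is the first projection, then a(ba) = a, and associating (ab)(ba) gives
    a, although neither factor is a. *)
Lemma type_aab_ne_fst a b : sole_nonassociative op a a b -> w <> (fun x _ => x).
Proof.
move=> aab wE; have assoc := assoc_off aab; have [ca cb ea] := type_aab_products aab.
have ab : a <> b by move=> e; apply: ca; rewrite -e opxx.
have f_a : a ** (a ** (b ** a)) = a by rewrite -/(w a b) wE.
have g_a : a ** (b ** a) = a.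
  have ge := type_aab_off aab.
  by rewrite -{1}f_a assoc ?(assoc a) ?opxx //; tauto.
suff : (a ** b) ** (b ** a) = a.
  by case/(irreducible aab) => //; constructor.
by rewrite -assoc ?(assoc a b b) ?opxx ?(assoc a b a) //; auto.
Qed.

(** With ba outside {a, b}, none of the triples of the band computation at
    (a, b) is (a, b, a). *)
Lemma type_aba_B a b : sole_nonassociative op a b a ->
  b ** a <> a -> b ** a <> b -> in_variety_B w.
Proof.
move=> aba ea eb; have assoc := assoc_off aba.
have ab : a <> b by move=> e; apply: ea; rewrite -e opxx.
apply: (@in_variety_B_pair a b a a b) => //; [by constructor | by constructor | ].
apply: (@long_sandwich_B_at _ _ opxx (fun _ => True)) => //.
- by move=> *; apply: assoc; left; apply: nesym.
- by move=> *; apply: assoc; left.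
have gb : a ** (b ** a) <> b.
  move=> g_b; have t2 : [\/ b = a, b = b | b = a] by constructor 2.
  by case: (irreducible aba t2 g_b).
by split; apply: assoc; tauto.
Qed.

(** As for (a, a, b), the equation (ab)(ba) = a contradicts irreducibility:
    ab = a is excluded because it makes (ab)a and a(ba) both equal to a. *)
Lemma type_aba_ne_fst a b : sole_nonassociative op a b a ->
  b ** a <> a -> b ** a <> b -> w <> (fun x _ => x).
Proof.
move=> aba ea eb wE; have assoc := assoc_off aba; have [ne _] := aba.
have ab : a <> b by move=> e; apply: ea; rewrite -e opxx.
have g_a : a ** (b ** a) = a.
  rewrite -[RHS](congr1 (fun f => f a b) wE) /w -(assoc a a) ?opxx //; auto.
have : (a ** b) ** (b ** a) = a.
  by rewrite assoc -?(assoc b b) ?opxx //; auto.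
case/(irreducible aba) => // [ | c_a]; first by constructor.
by apply: ne; rewrite g_a c_a opxx.
Qed.

(** Otherwise {a, b} is closed under multiplication, and each of its four
    possible tables has (ab)a = a(ba).  Passing to the dual exchanges the two
    alternatives. *)
Lemma type_aba_products a b : sole_nonassociative op a b a ->
  (b ** a <> a /\ b ** a <> b) \/ (a ** b <> a /\ a ** b <> b).
Proof.
move=> [ne _]; apply: NNPP => H; apply: ne.
have [ba | ba] : b ** a = a \/ b ** a = b by tauto.
  have [-> | ->] : a ** b = a \/ a ** b = b by tauto.
    by rewrite ba.
  by rewrite ba opxx.
have [abE | abE] : a ** b = a \/ a ** b = b by tauto.
  by rewrite ba abE opxx.
by rewrite ba abE ba.
Qed.

(** * Triples with distinct entries *)

(** One of three distinct entries is different from both x and y. *)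
Lemma distinct_B a b c : sole_nonassociative op a b c ->
  a <> b -> b <> c -> a <> c -> in_variety_B w.
Proof.
move=> abc ab bc ac.
apply: in_variety_B_at => [x | x y]; first by rewrite /w !opxx.
have [t [t_abc xt yt]] : exists t, [/\ [\/ t = a, t = b | t = c], x <> t & y <> t].
  have [xa | xa] := classic (x = a); have [ya | ya] := classic (y = a).
  - by exists b; split; [constructor 2 | rewrite xa | rewrite ya].
  - have [yb | yb] := classic (y = b).
      by exists c; split; [constructor 3 | rewrite xa | rewrite yb].
    by exists b; split; [constructor 2 | rewrite xa | ].
  - have [xb | xb] := classic (x = b).
      by exists c; split; [constructor 3 | rewrite xb | rewrite ya].
    by exists b; split; [constructor 2 | | rewrite ya].
  - by exists a; split; [constructor 1 | | ].
exact: (B_at_avoiding abc t_abc).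
Qed.

(** Read off from the factorization a = a(ca): the remaining option of
    [left_factor], ca = b, is excluded by the irreducibility of b. *)
Lemma rectangular_factor a b c : sole_nonassociative op a b c ->
  a <> b -> b <> c -> (forall x y, x ** (y ** x) = x) ->
  c ** a = a \/ (c ** a) ** b = b.
Proof.
move=> abc ab bc rect.
case: (left_factor abc (rect a c)) => [ | [_ [ | ca]]]; [by left | by right | ].
by case: (middle_irreducible abc ca) => e; [case: bc; rewrite e | case: ab; rewrite e].
Qed.

(** If ca = a, then ac = c, ba = b and ab = a.  For bc = b the triple (c, b, a)
    gives a = c; otherwise d = a(bc) satisfies cd = d = dc, and rectangularity
    forces d = c = (ab)c. *)
Lemma rectangular_left a b c : sole_nonassociative op a b c ->
  a <> b -> b <> c -> a <> c -> (forall x y, x ** (y ** x) = x) ->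
  b ** (c ** a) = b -> c ** a <> a.
Proof.
move=> abc ab bc ac rect bca ca; have assoc := assoc_off abc; have [ne _] := abc.
have ca_ne : c <> a by apply: nesym.
have acE : a ** c = c by rewrite -{2}(rect c a) -assoc ?ca //; auto.
have ba : b ** a = b by rewrite -{1}ca.
have abE : a ** b = a by rewrite -{2}(rect a b) ba.
have [bcE | bc_b] := classic (b ** c = b).
  have cb : c ** b = c by rewrite -{2}(rect c b) bcE.
  by apply: ac; rewrite -[LHS]ca -{1}cb assoc ?ba ?cb //; auto.
set d := a ** (b ** c) in ne.
have cd : c ** d = d by rewrite -assoc ?ca //; auto.
have dc : d ** c = d.
  rewrite /d assoc; last by tauto.
  by rewrite (assoc b) ?opxx //; left; apply: nesym.
by apply: ne; rewrite abE acE -[LHS](rect c d) dc.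
Qed.

End SzaszHajekTypes.

(** By [rectangular_factor] and its dual, ca = a or (ca)b = b, and ca = c or
    b(ca) = b.  The mixed cases fall to [rectangular_left] and its dual.  In the
    case (ca)b = b = b(ca), rectangularity gives ca = b, against the
    irreducibility of b. *)
Lemma distinct_ne_fst (A : Type) (op : A -> A -> A) (a b c : A) :
  idempotent_op op -> sole_nonassociative op a b c ->
  a <> b -> b <> c -> a <> c -> long_sandwich op <> (fun x _ => x).
Proof.
move=> opxx abc ab bc ac wE; have assoc := assoc_off abc.
have rect x y : op x (op y x) = x.
  rewrite -[RHS](congr1 (fun f => f x y) wE) /long_sandwich -(assoc x x) ?opxx //.
  by have [-> | ] := classic (x = a); tauto.
have rect_dual x y : dual op x (dual op y x) = x.
  rewrite /dual assoc ?rect //; have [-> | ] := classic (x = a); tauto.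
have cba := sole_nonassociative_dual abc.
have [bca cab] : op b (op c a) = b /\ op (op c a) b = b.
  have [cb ba ca] : [/\ c <> b, b <> a & c <> a] by split; apply: nesym.
  have F1 := rectangular_factor abc ab bc rect.
  have F2 := rectangular_factor cba cb ba rect_dual.
  have L1 := rectangular_left opxx abc ab bc ac rect.
  have L2 := rectangular_left (op := dual op) opxx cba cb ba ca rect_dual.
  rewrite /dual in F2 L2.
  case: F1 => F1; case: F2 => F2.
  - by case: ac; rewrite -F1 F2.
  - by case: (L1 F2).
  - by case: (L2 F1).
  - by [].
have ca : op c a = b by rewrite -[LHS](rect _ b) bca.
by case: (middle_irreducible abc ca) => e; [case: bc; rewrite e | case: ab; rewrite e].
Qed.

Theorem theorem3p3 (A : Type) (op : A -> A -> A) (hSH : SH_groupoid op) :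
  has_minimal_clone op <-> in_variety_B op \/ in_variety_B (dual op).
Proof.
case: hSH => [[[a b] c] [/= ne_abc unique_abc]].
have abc : sole_nonassociative op a b c.
  split=> // x y z ne; apply: NNPP => /(unique_abc (x, y, z)) [? ? ?]; subst.
  by case: ne => [|[|]].
split=> [minop | [opB | opB]]; last first.
- apply/has_minimal_clone_dual/B_minimal => //.
    move=> dE; apply: (not_associative abc) => x y z.
    have opE u v : op u v = v by exact: (congr1 (fun f => f v u) dE).
    by rewrite !opE.
  move=> dE; apply: (not_associative abc) => x y z.
  have opE u v : op u v = u by exact: (congr1 (fun f => f v u) dE).
  by rewrite !opE.
- by apply: B_minimal => // opE; apply: (not_associative abc) => x y z; rewrite opE.
have [opxx _] := minop.
have conclude (s : A -> A -> A) x y z :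
    has_minimal_clone s -> sole_nonassociative s x y z ->
    in_variety_B (long_sandwich s) -> long_sandwich s <> (fun x _ => x) ->
    in_variety_B s \/ in_variety_B (dual s).
  move=> mins xyz; apply: B_term_reduction => //; first exact: not_associative xyz.
  exact: long_sandwich_binary_term.
have mindual : has_minimal_clone (dual op) by apply/has_minimal_clone_dual.
have cba := sole_nonassociative_dual abc.
have or_dual : in_variety_B (dual op) \/ in_variety_B (dual (dual op)) ->
  in_variety_B op \/ in_variety_B (dual op) by case; auto.
have [ac | ac] := classic (a = c).
  subst c; case: (type_aba_products opxx abc) => [[ea eb] | [ea eb]].
    apply: (conclude _ _ _ _ minop abc).
      exact: (type_aba_B opxx abc).
    exact: (type_aba_ne_fst opxx abc).
  apply/or_dual/(conclude _ _ _ _ mindual cba).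
    exact: (type_aba_B (op := dual op) opxx cba).
  exact: (type_aba_ne_fst (op := dual op) opxx cba).
have [ab | ab] := classic (a = b).
  subst b; apply: (conclude _ _ _ _ minop abc).
    exact: (type_aab_B opxx abc).
  exact: (type_aab_ne_fst opxx abc).
have [bc | bc] := classic (b = c).
  subst c; apply/or_dual/(conclude _ _ _ _ mindual cba).
    exact: (type_aab_B (op := dual op) opxx cba).
  exact: (type_aab_ne_fst (op := dual op) opxx cba).
apply: (conclude _ _ _ _ minop abc).
  exact: (distinct_B opxx abc).
exact: (distinct_ne_fst opxx abc).
Qed.
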